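(* Let $t>0$. The transformations $\mathcal{N}$ and $\mathcal{Q}$ on $C([0,t];\mathbb{R})$ enjoy the following properties: (i) for every $\phi\in C([0,t];\mathbb{R})$, $\mathcal{N}(\phi)(0)=\phi_t$ and $\mathcal{N}(\phi)(t)=\phi_0$; (ii) $\mathcal{N}\circ\mathcal{N}=\mathrm{Id}$ and $\mathcal{Q}\circ\mathcal{N}=\mathcal{Q}$, where $\mathrm{Id}$ is the identity map on $C([0,t];\mathbb{R})$; (iii) for every $\phi\in C([0,t];\mathbb{R})$, the time reversal of $\mathcal{N}(\phi)$ equals $\mathcal{N}(\mathring{\phi})$, i.e. $\mathcal{N}(\phi)(t-s)=\mathcal{N}(\mathring{\phi})(s)$ for all $0\le s\le t$.
   Context: Fix $t>0$. $C([0,t];\mathbb{R})$ is the space of real-valued continuous functions on $[0,t]$. The time reversal of $\phi$ is $\mathring{\phi}_s:=\phi_{t-s}$. For $\phi\in C([0,t];\mathbb{R})$ and $0\le s\le t$, $$\mathcal{N}(\phi)(s)=\phi_s+\Bigl|\phi_t-\phi_0+\min_{0\le u\le s}\phi_u-\min_{s\le u\le t}\phi_u\Bigr|-\Bigl|\min_{0\le u\le s}\phi_u-\min_{s\le u\le t}\phi_u\Bigr|,$$ $$\mathcal{Q}(\phi)(s)=\phi_s-2\min_{0\le u\le s}\phi_u+\phi_0.$$ *)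

(* Defs.v *)
From HB Require Import structures.
From mathcomp Require Import all_boot all_order all_algebra.
From mathcomp Require Import all_classical all_reals all_analysis.
From mathcomp Require Import lra.

Set Implicit Arguments.
Unset Strict Implicit.
Unset Printing Implicit Defensive.

Import Order.TTheory GRing.Theory Num.Theory.
Import numFieldNormedType.Exports.

Local Open Scope classical_set_scope.
Local Open Scope ring_scope.

Definition seg_set {R : realType} (t : R) : set R := `[0, t].

(* [0, t] as a type, with the subtype topology: maps out of it have no values
   outside [0, t]. *)
Notation seg t := (set_type (seg_set t)).

(* C([0, t]; R), with Leibniz equality extensional by continuousEP. *)
Notation cpath R t := (continuousType (seg (t : R)) R).

Section segment.
Context {R : realType} {t : R}.

Lemma seg_bounds (s : seg t) : 0 <= \val s <= t.
Proof. by have := set_valP s; rewrite /seg_set /= in_itv. Qed.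

Lemma mkseg_proof (x : R) : 0 <= x <= t -> x \in seg_set t.
Proof. by move=> x0t; rewrite inE /seg_set /= in_itv. Qed.

Definition mkseg (x : R) (x0t : 0 <= x <= t) : seg t :=
  exist _ x (mkseg_proof x0t).

Lemma left_proof (t0 : 0 < t) : 0 <= (0 : R) <= t.
Proof. by rewrite lexx ltW. Qed.

Lemma right_proof (t0 : 0 < t) : 0 <= t <= t.
Proof. by rewrite lexx ltW. Qed.

Definition seg_left (t0 : 0 < t) : seg t := mkseg (left_proof t0).

Definition seg_right (t0 : 0 < t) : seg t := mkseg (right_proof t0).

Lemma seg_rev_proof (s : seg t) : 0 <= t - \val s <= t.
Proof. by have /andP[? ?] := seg_bounds s; apply/andP; split; lra. Qed.

Definition seg_rev (s : seg t) : seg t := mkseg (seg_rev_proof s).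

Lemma val_continuous : continuous (\val : seg t -> R).
Proof. exact: initial_continuous. Qed.

Lemma seg_rev_continuous : continuous seg_rev.
Proof.
have cB (X : topologicalType) (f : X -> R) :
    continuous f -> continuous (fun x => t - f x).
  by move=> cf x; apply: cvgB; [exact: cvg_cst|exact: cf].
apply: (@continuous_comp_initial (seg t) (seg t) R set_val seg_rev).
exact: (cB (seg t) _ val_continuous).
Qed.

End segment.

Section path_min.
Context {R : realType} {t : R}.
Implicit Types (phi : seg t -> R) (a b s : seg t).

(* min_{a <= u <= b} phi_u. For a <= b and phi continuous the infimum is
   attained: see path_minP. *)
Definition path_min phi a b : R :=
  inf (phi @` [set u | \val a <= \val u <= \val b]).

Lemma path_min_attained phi a b : continuous phi -> \val a <= \val b ->
  exists2 c, \val a <= \val c <= \val b &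
    forall u, \val a <= \val u <= \val b -> phi c <= phi u.
Proof.
move=> cphi ab.
have cvL : {within `[\val a, \val b], continuous (valL phi)}.
  apply: (@continuous_subspaceW _ _ _ (seg_set t)).
    move=> x; rewrite /seg_set /= !in_itv/= => /andP[ax xb].
    have /andP[a0 _] := seg_bounds a; have /andP[_ bt] := seg_bounds b.
    by rewrite (le_trans a0)// (le_trans xb).
  exact/subspace_valL_continuousP.
have [c cab cmin] := EVT_min ab cvL.
have in0t x : x \in `[\val a, \val b] -> 0 <= x <= t.
  rewrite in_itv/= => /andP[ax xb].
  have /andP[a0 _] := seg_bounds a; have /andP[_ bt] := seg_bounds b.
  by rewrite (le_trans a0)// (le_trans xb).
have valLE (u : seg t) : valL phi (\val u) = phi u.
  by have := congr1 (@^~ u) (@valLK _ _ point (seg_set t) phi).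
exists (mkseg (in0t _ cab)); first by have := cab; rewrite in_itv.
move=> u uab; rewrite -!valLE; apply: cmin.
by rewrite in_itv.
Qed.

Lemma path_minP phi a b : continuous phi -> \val a <= \val b ->
  let A := phi @` [set u | \val a <= \val u <= \val b] in
  A (path_min phi a b) /\ lbound A (path_min phi a b).
Proof.
move=> cphi ab A; have [c cab cmin] := path_min_attained cphi ab.
have lbA : lbound A (phi c) by move=> _ [u uab <-]; exact: cmin.
suff -> : path_min phi a b = phi c by split => //; exists c.
apply/eqP; rewrite eq_le; apply/andP; split.
  by apply: ge_inf; [exists (phi c)|exists c].
by apply: lb_le_inf => //; exists (phi c), c.
Qed.

Lemma path_min_le phi a b u : continuous phi -> \val a <= \val u <= \val b ->
  path_min phi a b <= phi u.
Proof.
move=> cphi /andP[au ub]; have [_] := path_minP cphi (le_trans au ub).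
by apply; exists u => //=; rewrite au.
Qed.

Lemma path_min_rev phi a b :
  path_min phi a b = path_min (phi \o seg_rev) (seg_rev b) (seg_rev a).
Proof.
rewrite /path_min; congr inf; apply/seteqP; split => [_ [u /= uab <-]|].
  exists (seg_rev u) => /=; first by move: uab => /andP[? ?]; apply/andP; split; lra.
  by congr phi; apply: val_inj => /=; rewrite subKr.
move=> _ [u /= uab <-]; exists (seg_rev u) => //=.
by move: uab => /andP[? ?]; apply/andP; split; lra.
Qed.

Lemma continuous_distP (X : topologicalType) (f : X -> R) : continuous f <->
  forall x e, 0 < e -> \forall y \near x, `|f x - f y| <= e.
Proof.
split=> cf x; first by move=> e e0; have /cvgrPdist_le := cf x; exact.
by apply/cvgrPdist_le => e e0; exact: cf.
Qed.

Lemma prefix_min_continuous (t0 : 0 < t) phi : continuous phi ->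
  continuous (path_min phi (seg_left t0)).
Proof.
move=> cphi; apply/continuous_distP => s e e0.
have e20 : 0 < e / 2 by rewrite divr_gt0.
have [B [[U oU <-] /= Us UB]] := (continuous_distP phi).1 cphi s _ e20.
have /nbhs_ballP[d /= d0 dU] : nbhs (\val s) U by exact: open_nbhs_nbhs.
have close u : `|\val s - \val u| < d -> `|phi s - phi u| <= e / 2.
  by move=> sud; apply: UB; exact: dU.
(* comparison of two points a <= b of the ball of radius d around s *)
have step a b : \val a <= \val b -> `|\val s - \val a| < d ->
    `|\val s - \val b| < d ->
    `|path_min phi (seg_left t0) a - path_min phi (seg_left t0) b| <= e.
  move=> ab sa sb.
  have /andP[a0 _] := seg_bounds a; have /andP[b0 _] := seg_bounds b.
  have [[c /= /andP[c0 ca] cE] _] := @path_minP phi (seg_left t0) a cphi a0.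
  have [[f /= /andP[f0 fb] fE] _] := @path_minP phi (seg_left t0) b cphi b0.
  have ba : path_min phi (seg_left t0) b <= path_min phi (seg_left t0) a.
    by rewrite -cE; apply: path_min_le => //=; rewrite c0 (le_trans ca).
  rewrite ger0_norm ?subr_ge0// -fE.
  have [fa|af] := leP (\val f) (\val a).
    have : path_min phi (seg_left t0) a <= phi f.
      by apply: path_min_le => //=; rewrite f0.
    lra.
  have sf : `|\val s - \val f| < d.
    move: sa sb af; rewrite !ltr_norml /= => /andP[? ?] /andP[? ?] ?.
    by apply/andP; split; lra.
  have aa : path_min phi (seg_left t0) a <= phi a.
    by apply: path_min_le => //=; rewrite a0 lexx.
  have := close _ sa; have := close _ sf.
  by rewrite !ler_norml => /andP[? ?] /andP[? ?]; lra.
have d20 : 0 < d / 2 by rewrite divr_gt0.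
have near_s := (continuous_distP (\val : seg t -> R)).1 val_continuous s _ d20.
apply: filterS near_s => u su'.
have su : `|\val s - \val u| < d by apply: le_lt_trans su' _; lra.
have ss : `|\val s - \val s| < d by rewrite subrr normr0.
have [sb|/ltW bs] := leP (\val s) (\val u); first exact: step.
by rewrite distrC; exact: step.
Qed.

Lemma suffix_min_continuous (t0 : 0 < t) phi : continuous phi ->
  continuous (fun s => path_min phi s (seg_right t0)).
Proof.
move=> cphi.
have -> : (fun s => path_min phi s (seg_right t0)) =
    path_min (phi \o seg_rev) (seg_left t0) \o seg_rev.
  apply/funext => s; rewrite path_min_rev /=; congr path_min.
  by apply: val_inj; rewrite /= subrr.
have cr : continuous (phi \o seg_rev).
  by move=> u; apply: continuous_comp; [exact: seg_rev_continuous|exact: cphi].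
move=> s; apply: continuous_comp; first exact: seg_rev_continuous.
exact: prefix_min_continuous.
Qed.

End path_min.

Section transformations.
Context {R : realType} {t : R} (t0 : 0 < t).
Implicit Types (phi : cpath R t) (s : seg t).

Local Notation o := (seg_left t0).
Local Notation T := (seg_right t0).

Definition N_fun (phi : seg t -> R) s : R :=
  phi s
  + `|phi T - phi o + path_min phi o s - path_min phi s T|
  - `|path_min phi o s - path_min phi s T|.

Definition Q_fun (phi : seg t -> R) s : R :=
  phi s - 2 * path_min phi o s + phi o.

Lemma N_continuous phi : continuous (N_fun phi).
Proof.
have cN (X : topologicalType) (f p q : X -> R) (c : R) :
    continuous f -> continuous p -> continuous q ->
    continuous (fun x => f x + `|c + p x - q x| - `|p x - q x|).
  move=> cf cp cq x; apply: cvgB; [apply: cvgD; first exact: cf|].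
    by apply: cvg_norm; apply: cvgB; [apply: cvgD|];
      [exact: cvg_cst|exact: cp|exact: cq].
  by apply: cvg_norm; apply: cvgB; [exact: cp|exact: cq].
have cphi := @cts_fun _ _ phi.
have cp := prefix_min_continuous (t0 := t0) cphi.
have cs := suffix_min_continuous (t0 := t0) cphi.
exact: (cN (seg t) _ _ _ (phi T - phi o) cphi cp cs).
Qed.

Lemma Q_continuous phi : continuous (Q_fun phi).
Proof.
have cQ (X : topologicalType) (f p : X -> R) (c : R) :
    continuous f -> continuous p -> continuous (fun x => f x - 2 * p x + c).
  move=> cf cp x; apply: cvgD; last exact: cvg_cst.
  by apply: cvgB; [exact: cf|apply: cvgM; [exact: cvg_cst|exact: cp]].
have cphi := @cts_fun _ _ phi.
have cp := prefix_min_continuous (t0 := t0) cphi.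
exact: (cQ (seg t) _ _ (phi o) cphi cp).
Qed.

Definition N phi : cpath R t := mkcts (@N_continuous phi).

Definition Q phi : cpath R t := mkcts (@Q_continuous phi).

Definition time_rev phi : cpath R t := phi \o mkcts seg_rev_continuous.

End transformations.

(* Main.v *)
Require Import Defs.
From mathcomp Require Import all_boot all_order all_algebra.
From mathcomp Require Import all_classical all_reals all_analysis.
From mathcomp Require Import lra.
Import Order.TTheory GRing.Theory Num.Theory.
Import numFieldNormedType.Exports.
Local Open Scope ring_scope.

(* Write I s and J s for the minima of phi over [0, s] and [s, t], and put
   d = phi t - phi 0, D = I - J, g = |d + D| - |D|, so that N phi = phi + g.
   The key point is that the prefix minimum of N phi at s is
   I s + (g s + d) / 2. The lower bound is linear arithmetic from
   I u >= I s >= min (I u) (J u) and J s >= J u >= min (I s) (J s) for u <= s.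
   It is attained either at a minimizer a of phi on [0, s], or, when
   d >= 0 and I s < J s, at the last passage of phi before s at the level
   min (J s) (I s + d), or, when d < 0 and I s + d <= J s, at the first passage
   of phi at the level min (I s) (J s) - d, which occurs before a. Since N
   commutes with time reversal, the suffix minimum of N phi is
   J s + (g s - d) / 2. Hence N replaces d by -d and D by D + d, and both
   N o N = id and Q o N = Q follow. *)

(** * Intermediate values and passage times of continuous paths *)

Section segment_paths.
Set Implicit Arguments.
Unset Strict Implicit.
Local Open Scope classical_set_scope.
Local Open Scope ring_scope.
Context {R : realType} {t : R}.
Implicit Types (f phi : seg t -> R) (a b c s u : seg t).

Lemma seg_revK u : seg_rev (seg_rev u) = u.
Proof. by apply: val_inj; rewrite /= subKr. Qed.

Lemma seg_rev_left (t0 : 0 < t) : seg_rev (seg_left t0) = seg_right t0.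
Proof. by apply: val_inj; rewrite /= subr0. Qed.

Lemma seg_rev_right (t0 : 0 < t) : seg_rev (seg_right t0) = seg_left t0.
Proof. by apply: val_inj; rewrite /= subrr. Qed.

Lemma seg_IVT f a b v : continuous f -> \val a <= \val b ->
  f a <= v <= f b -> exists2 c, \val a <= \val c <= \val b & f c = v.
Proof.
move=> cf ab /andP[av vb].
have valLE u : valL f (\val u) = f u.
  by have := congr1 (@^~ u) (@valLK _ _ point (seg_set t) f).
have in0t x : x \in `[\val a, \val b] -> 0 <= x <= t.
  rewrite in_itv/= => /andP[ax xb].
  have /andP[a0 _] := seg_bounds a; have /andP[_ bt] := seg_bounds b.
  by rewrite (le_trans a0)// (le_trans xb).
(* [valL f] takes a default value outside [0, t] and may jump at the ends, hence continuity only
   within [a, b]. *)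
have cvL : {within `[\val a, \val b], continuous (valL f)}.
  apply: (@continuous_subspaceW _ _ _ (seg_set t)).
    by move=> x /= xab; rewrite /seg_set /= in_itv/=; exact: in0t.
  exact/subspace_valL_continuousP.
have vfab : Num.min (valL f (\val a)) (valL f (\val b)) <= v <=
            Num.max (valL f (\val a)) (valL f (\val b)).
  by rewrite !valLE ge_min le_max av vb orbT.
have [x xab fx] := IVT ab cvL vfab.
exists (mkseg (in0t _ xab)); first by have := xab; rewrite in_itv.
by rewrite -fx -valLE.
Qed.

Lemma path_min_self phi s : path_min phi s s = phi s.
Proof.
rewrite /path_min (_ : [set u | _] = [set s]); last first.
  apply/seteqP; split=> u /=; last by move=> ->; rewrite lexx.
  by move=> sus; apply: val_inj; apply/eqP; rewrite eq_le andbC.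
by rewrite image_set1 inf1.
Qed.

Lemma path_min_ge phi a b v : continuous phi -> \val a <= \val b ->
  (forall u, \val a <= \val u <= \val b -> v <= phi u) ->
  v <= path_min phi a b.
Proof.
move=> cphi ab vphi; have [[u /= uab <-] _] := path_minP cphi ab.
exact: vphi.
Qed.

Lemma path_min_cat phi a b c : continuous phi ->
  \val a <= \val b -> \val b <= \val c ->
  path_min phi a c = Num.min (path_min phi a b) (path_min phi b c).
Proof.
move=> cphi ab bc; have ac := le_trans ab bc; apply/eqP.
rewrite eq_le le_min ge_min; apply/andP; split.
  apply/andP; split; apply: path_min_ge => // u /andP[? ?].
    by apply: path_min_le => //; apply/andP; split; lra.
  by apply: path_min_le => //; apply/andP; split; lra.
have [[u /= /andP[au uc] <-] _] := path_minP cphi ac.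
have [ub|/ltW bu] := leP (\val u) (\val b).
  by rewrite path_min_le ?au.
by rewrite (path_min_le (a := b)) ?bu ?uc ?orbT.
Qed.

Lemma seg_min_proof s u : 0 <= Num.min (\val s) (\val u) <= t.
Proof.
have /andP[s0 st] := seg_bounds s; have /andP[u0 _] := seg_bounds u.
by rewrite le_min s0 u0 ge_min st.
Qed.

(** Precomposing with [seg_min s] stops a path at time [s]. *)
Definition seg_min s u : seg t := mkseg (seg_min_proof s u).

Lemma seg_min_continuous s : continuous (seg_min s).
Proof.
apply: (@continuous_comp_initial (seg t) (seg t) R set_val (seg_min s)).
have -> : set_val \o seg_min s =
    (cst (\val s) : seg t -> R) \min (\val : seg t -> R) by [].
by move=> u; apply: continuous_min; [exact: cst_continuous|exact: val_continuous].
Qed.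

Lemma seg_min_id s u : \val u <= \val s -> seg_min s u = u.
Proof. by move=> us; apply: val_inj; rewrite /= min_r. Qed.

Lemma last_passage (t0 : 0 < t) phi a s v : continuous phi ->
  \val a <= \val s -> phi a <= v <= phi s ->
  exists c, [/\ \val a <= \val c <= \val s, phi c = v &
                v <= path_min phi c s].
Proof.
(* intermediate values of the suffix minimum of the path stopped at s *)
move=> cphi as_ /andP[av vs].
pose psi := phi \o seg_min s.
have cpsi : continuous psi.
  by move=> u; apply: continuous_comp; [exact: seg_min_continuous|exact: cphi].
have psiE u : \val u <= \val s -> psi u = phi u.
  by move=> us; rewrite /psi /= seg_min_id.
have psis u : \val s <= \val u -> psi u = phi s.
  by move=> su; congr phi; apply: val_inj; rewrite /= min_l.
have /andP[_ st] := seg_bounds s.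
have Ja : path_min psi a (seg_right t0) <= v.
  apply: le_trans av; rewrite -psiE//; apply: path_min_le => //=.
  by rewrite lexx (le_trans as_).
have Js : v <= path_min psi s (seg_right t0).
  by apply: path_min_ge => // u /andP[su _]; rewrite psis.
have [c /andP[ac cs] cv] := seg_IVT (f := fun u => path_min psi u (seg_right t0))
  (suffix_min_continuous (t0 := t0) cpsi) as_ (introT andP (conj Ja Js)).
have ct : \val c <= t by rewrite (le_trans cs).
(* The path need not equal [v] at [c]; a minimizer [e] after [c] does, and [seg_min s e] moves it
   back to [s] if it lies beyond. *)
have [[e /= /andP[ce et] ev] _] := path_minP (b := seg_right t0) cpsi ct.
exists (seg_min s e); split.
- by rewrite /= le_min as_ (le_trans ac ce) ge_min lexx.
- by rewrite -cv -ev.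
- apply: path_min_ge => // [|u /andP[/= eu us]]; first by rewrite /= ge_min lexx.
  rewrite -psiE// -cv; apply: path_min_le => //=.
  by rewrite (le_trans us st) andbT (le_trans _ eu)// le_min cs ce.
Qed.

(** This is the last passage of the reversed path. *)
Lemma first_passage (t0 : 0 < t) phi s b v : continuous phi ->
  \val s <= \val b -> phi b <= v <= phi s ->
  exists c, [/\ \val s <= \val c <= \val b, phi c = v &
                v <= path_min phi s c].
Proof.
move=> cphi sb vbs.
have cr : continuous (phi \o seg_rev).
  by move=> u; apply: continuous_comp; [exact: seg_rev_continuous|exact: cphi].
have [||c [/= /andP[bc cs] cv vc]] :=
  @last_passage t0 (phi \o seg_rev) (seg_rev b) (seg_rev s) v cr.
- by rewrite /= lerB.
- by rewrite /= !seg_revK.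
exists (seg_rev c); split => //; first by apply/andP; split => /=; lra.
by rewrite path_min_rev seg_revK.
Qed.

End segment_paths.

(** * Prefix and suffix minima of the transformed path *)

Section N_minima.
Set Implicit Arguments.
Unset Strict Implicit.
Context {R : realType} {t : R} (t0 : 0 < t).
Implicit Types (phi : cpath R t) (s u : seg t).

Local Notation o := (seg_left t0).
Local Notation T := (seg_right t0).

(** Here [x] stands for [phi u] with u <= s; the hypotheses record how the minima at [u] and [s]
    compare. *)
Lemma N_fun_prefix_bound (x d Iu Ju Is Js : R) :
  Iu <= x -> Ju <= x -> Is <= Iu -> Ju <= Js ->
  Num.min Iu Ju <= Is -> Num.min Is Js <= Ju ->
  Is + (`|d + Is - Js| - `|Is - Js| + d) / 2 <=
  x + `|d + Iu - Ju| - `|Iu - Ju|.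
Proof.
rewrite !ge_min => ? ? ? ? /orP[] ? /orP[] ?;
  case: (ler0P (d + Is - Js)) => ?; case: (ler0P (Is - Js)) => ?;
  case: (ler0P (d + Iu - Ju)) => ?; case: (ler0P (Iu - Ju)) => ?; lra.
Qed.

(** All four absolute values open with a plus sign, and both sides equal [I + d]. [J'] is the suffix
    minimum at the minimizer. *)
Lemma N_fun_attained_at_min (d I J J' : R) :
  J <= I -> J <= I + d -> J' <= I -> J' <= I + d ->
  I + `|d + I - J'| - `|I - J'| <= I + (`|d + I - J| - `|I - J| + d) / 2.
Proof. by move=> ? ? ? ?; rewrite !ger0_norm; lra. Qed.

(** At the last passage the path and its suffix minimum both equal [v], while the prefix minimum is
    still [I]. *)
Lemma N_fun_attained_last (d I J : R) (v := Num.min J (I + d)) :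
  0 <= d -> I < J ->
  v + `|d + I - v| - `|I - v| <= I + (`|d + I - J| - `|I - J| + d) / 2.
Proof.
rewrite /v; case: (leP J (I + d)) => ? ? ?;
  do ?[case: (ler0P (_ + _)) => ?]; lra.
Qed.

(** At the first passage the path and its prefix minimum equal [v - d] and the suffix minimum is
    [v]; both sides reduce to [v]. *)
Lemma N_fun_attained_first (d I J : R) (v := Num.min I J) :
  d < 0 -> I + d <= J ->
  v - d + `|d + (v - d) - v| - `|v - d - v| <=
  I + (`|d + I - J| - `|I - J| + d) / 2.
Proof.
rewrite /v; case: (leP I J) => ? ? ?;
  do ?[case: (ler0P (_ + _)) => ?]; lra.
Qed.

Lemma prefix_min_N phi s :
  path_min (N t0 phi) o s = path_min phi o s +
    (`|phi T - phi o + path_min phi o s - path_min phi s T| -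
     `|path_min phi o s - path_min phi s T| + (phi T - phi o)) / 2.
Proof.
have cphi := @cts_fun _ _ phi; have cN := @cts_fun _ _ (N t0 phi).
have /andP[s0 st] := seg_bounds s.
set d := phi T - phi o; pose I u := path_min phi o u; pose J u := path_min phi u T.
rewrite -/(I s) -/(J s).
have NE u : N t0 phi u = phi u + `|d + I u - J u| - `|I u - J u| by [].
have I0 u : I u <= phi u.
  by apply: path_min_le => //; have /andP[] := seg_bounds u => /= -> _; rewrite lexx.
have J0 u : J u <= phi u.
  by apply: path_min_le => //; have /andP[] := seg_bounds u => /= _ ->; rewrite lexx.
have Icat u v : \val u <= \val v -> I v = Num.min (I u) (path_min phi u v).
  by move=> uv; apply: path_min_cat => //; have /andP[] := seg_bounds u.
have Jcat u v : \val u <= \val v -> J u = Num.min (path_min phi u v) (J v).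
  by move=> uv; apply: path_min_cat => //; have /andP[] := seg_bounds v.
have IJ u v : \val u <= \val v ->
    [/\ I v <= I u, J u <= J v, Num.min (I u) (J u) <= I v &
        Num.min (I v) (J v) <= J u].
  move=> uv; rewrite (Icat _ _ uv) (Jcat _ _ uv).
  move: (path_min phi u v) => m.
  split.
  - by rewrite ge_min lexx.
  - by rewrite ge_min lexx orbT.
  - by rewrite !le_min !ge_min !lexx !orbT.
  - by rewrite !le_min !ge_min !lexx !orbT.
apply/eqP; rewrite eq_le; apply/andP; split; last first.
  apply: path_min_ge => // u /andP[u0 us]; rewrite NE.
  by have [? ? ? ?] := IJ _ _ us; apply: N_fun_prefix_bound.
suff [c cs Nc] : exists2 c, \val c <= \val s &
    N t0 phi c <= I s + (`|d + I s - J s| - `|I s - J s| + d) / 2.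
  apply: le_trans Nc; apply: path_min_le => //.
  by rewrite cs andbT; have /andP[] := seg_bounds c.
have [[a /= /andP[a0 as_] aI] _] := @path_minP _ _ phi o s cphi s0.
rewrite -/(I s) in aI.
have [Isa Jas _ _] := IJ _ _ as_.
have Ia : I a = I s by apply: le_anti; rewrite Isa andbT -aI I0.
have Ja : J a <= I s by rewrite -aI.
have [d0|d0] := leP 0 d.
  have [JI|IJs] := leP (J s) (I s).
    by exists a; rewrite // NE aI Ia; apply: N_fun_attained_at_min;
      rewrite // (le_trans _ (_ : I s <= I s + d)) ?lerDl.
  have [] := @last_passage _ _ t0 phi a s (Num.min (J s) (I s + d)) cphi as_.
    by rewrite aI le_min ge_min J0 lerDl d0 (ltW IJs).
  set v := Num.min _ _ => c [/andP[ac cs] cv vc]; exists c => //.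
  have [Isc _ _ _] := IJ _ _ cs; have [Ica _ _ _] := IJ _ _ ac.
  have Ic : I c = I s by apply: le_anti; rewrite Isc andbT -Ia.
  (* On [c, s] the path stays above [v = phi c], and on [s, t] above [J s >= v]. *)
  have Jc : J c = v.
    by apply: le_anti; rewrite -{1}cv J0 (Jcat _ _ cs) le_min vc /v ge_min lexx.
  by rewrite NE Ic Jc cv; exact: N_fun_attained_last.
have [JI|IJs] := ltP (J s) (I s + d).
  exists a; rewrite // NE aI Ia; apply: N_fun_attained_at_min; rewrite ?(ltW JI)//.
    by rewrite (le_trans (ltW JI))// gerDl ltW.
  exact: le_trans Jas (ltW JI).
(* The level is at most [phi o] because [J s <= phi T = phi o + d], and at least [phi a = I s]
   because [I s + d <= J s] and [d < 0]. *)
have dE : phi T = phi o + d by rewrite addrC subrK.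
have JsT : J s <= phi T by apply: path_min_le => //=; rewrite st lexx.
have [] := @first_passage _ _ t0 phi o a (Num.min (I s) (J s) - d) cphi a0.
  rewrite aI; have [?|?] := leP (I s) (J s); apply/andP; split;
    move: dE JsT d0 IJs; clearbody d; lra.
set v := Num.min _ _ => c [/andP[oc ca] cv vc].
exists c; first exact: le_trans as_.
have Ic : I c = v - d by apply: le_anti; rewrite vc andbT -cv I0.
have cs := le_trans ca as_.
have [_ Jcs _ vJ] := IJ _ _ cs; have [_ Jca _ _] := IJ _ _ ca.
(* [c, t] contains both [a], where the path equals [I s], and [s, t]. *)
have Jc : J c = v.
  by apply: le_anti; rewrite vJ le_min Jcs (le_trans Jca Ja).
by rewrite NE Ic Jc cv; exact: N_fun_attained_first.
Qed.

Lemma time_rev_N phi : time_rev (N t0 phi) = N t0 (time_rev phi).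
Proof.
apply/continuousEP => s.
change (N_fun t0 phi (seg_rev s) = N_fun t0 (phi \o seg_rev) s).
rewrite /N_fun.
rewrite (path_min_rev _ o) (path_min_rev _ _ T) /= seg_revK seg_rev_left seg_rev_right.
set p := path_min _ s T; set q := path_min _ o s.
have -> : phi T - phi o + p - q = - (phi o - phi T + q - p) by lra.
by rewrite normrN (distrC p).
Qed.

(** Reversal swaps prefix and suffix minima and negates the increment [phi T - phi o], leaving both
    absolute values unchanged. *)
Lemma suffix_min_N phi s :
  path_min (N t0 phi) s T = path_min phi s T +
    (`|phi T - phi o + path_min phi o s - path_min phi s T| -
     `|path_min phi o s - path_min phi s T| - (phi T - phi o)) / 2.
Proof.
rewrite path_min_rev seg_rev_right.
have -> : N t0 phi \o seg_rev = N t0 (time_rev phi) by rewrite -time_rev_N.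
rewrite prefix_min_N (path_min_rev phi s) (path_min_rev phi o) seg_rev_left seg_rev_right.
change (time_rev phi : _ -> _) with (phi \o seg_rev).
rewrite /= seg_rev_left seg_rev_right.
set p := path_min _ o _; set q := path_min _ _ T.
have -> : phi T - phi o + q - p = - (phi o - phi T + p - q) by lra.
by rewrite normrN (distrC p) opprB.
Qed.

(** At time 0 the prefix minimum is [phi o] and the suffix minimum is the global one, so both
    absolute values open with a plus sign. *)
Lemma N_left phi : N t0 phi o = phi T.
Proof.
rewrite -[LHS]/(N_fun t0 phi o) /N_fun path_min_self.
set m := path_min _ _ _.
have mo : m <= phi o by apply: path_min_le; [exact: cts_fun|rewrite /= lexx ltW].
have mT : m <= phi T by apply: path_min_le; [exact: cts_fun|rewrite /= lexx ltW].
rewrite !ger0_norm; lra.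
Qed.

End N_minima.

Theorem proposition3p6 (R : realType) (t : R) (t0 : 0 < t) :
  (forall phi : cpath R t,
     N t0 phi (seg_left t0) = phi (seg_right t0) /\
     N t0 phi (seg_right t0) = phi (seg_left t0)) /\
  (N t0 \o N t0 = idfun /\ Q t0 \o N t0 = Q t0) /\
  (forall phi : cpath R t, time_rev (N t0 phi) = N t0 (time_rev phi)).
Proof.
have NT phi : N t0 phi (seg_right t0) = phi (seg_left t0).
  have := N_left t0 (time_rev phi); rewrite -time_rev_N.
  rewrite -[LHS]/(N t0 phi (seg_rev (seg_left t0))).
  rewrite -[RHS]/(phi (seg_rev (seg_right t0))).
  by rewrite seg_rev_left seg_rev_right.
split; first by move=> phi; split; [exact: N_left|exact: NT].
split; last exact: time_rev_N.
split; apply/funext => phi; apply/continuousEP => s.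
  change (N_fun t0 (N t0 phi) s = phi s).
  rewrite {1}/N_fun prefix_min_N suffix_min_N N_left NT.
  change (N t0 phi s) with (N_fun t0 phi s); rewrite /N_fun.
  set d := _ - phi (seg_left t0); set I := path_min _ _ s; set J := path_min _ s _.
  set A := `|_|; set B := `|_|.
  (* The second application exchanges the two absolute values [A] and [B], so the corrections
     cancel. *)
  have -> : phi (seg_left t0) - phi (seg_right t0) + (I + (A - B + d) / 2) -
    (J + (A - B - d) / 2) = I - J by rewrite /d; lra.
  have -> : I + (A - B + d) / 2 - (J + (A - B - d) / 2) = d + I - J by lra.
  rewrite -/A -/B; lra.
change (Q_fun t0 (N t0 phi) s = Q_fun t0 phi s).
(* Doubling the prefix minimum absorbs the correction [A - B]; the leftover [-d] turns [phi T] into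
   [phi o]. *)
rewrite /Q_fun prefix_min_N N_left.
change (N t0 phi s) with (N_fun t0 phi s); rewrite /N_fun; lra.
Qed.
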